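(* Let $(A,X)$ be a primitive axial algebra (for some fusion law $\mathcal{F}\subseteq\mathbb{F}$ over a field $\mathbb{F}$) with a Frobenius form $(\cdot,\cdot)$ such that $(a,a)\neq 0$ for all $a\in X$. Then $R(A)=J(A)=A^\perp$.
   Context: Algebras are not assumed associative or unital. A fusion law is a set $\mathcal{F}\subseteq\mathbb{F}$ ($\mathbb{F}$ a field, always $1\in\mathcal{F}$) with a map $\ast:\mathcal{F}\times\mathcal{F}\to 2^{\mathcal{F}}$. For a commutative $\mathbb{F}$-algebra $A$, $a\in A$ and $\lambda\in\mathbb{F}$ let $A_\lambda(a)=\{u\in A\mid au=\lambda u\}$, and for $\Lambda\subseteq\mathbb{F}$ let $A_\Lambda(a)=\bigoplus_{\lambda\in\Lambda}A_\lambda(a)$. A non-zero idempotent $a\in A$ is an axis for $\mathcal{F}$ if $A=A_{\mathcal{F}}(a)$ and $A_\lambda(a)A_\mu(a)\subseteq A_{\lambda\ast\mu}(a)$ for all $\lambda,\mu\in\mathcal{F}$; it is primitive if $A_1(a)=\mathbb{F}a$. A primitive axial algebra for $\mathcal{F}$ is a pair $(A,X)$ with $A$ a commutative $\mathbb{F}$-algebra and $X\subseteq A$ a set of primitive axes for $\mathcal{F}$ generating $A$ as an algebra. The axial radical $R(A)$ is the unique largest ideal of $A$ containing no element of $X$ (it is known to exist). The Jacobson radical $J(A)$ is the intersection of all maximal ideals of $A$ (maximal among proper ideals), with $J(A)=A$ if there are no maximal ideals. A Frobenius form on $A$ is a bilinear form $(\cdot,\cdot):A\times A\to\mathbb{F}$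 with $(uv,w)=(u,vw)$ for all $u,v,w\in A$. $A^\perp=\{u\in A\mid (u,v)=0\text{ for all }v\in A\}$. *)

(* Defs.v *)
From HB Require Import structures.
From mathcomp Require Import all_boot all_order all_algebra.
From mathcomp Require Import boolp classical_sets.

Set Implicit Arguments.
Unset Strict Implicit.
Unset Printing Implicit Defensive.

Import GRing.Theory.

Local Open Scope classical_set_scope.
Local Open Scope ring_scope.

(* The map [fl_star] is only meaningful on pairs of elements of [fl_set]: every
   use below is guarded by membership, so values elsewhere are irrelevant. *)
Record fusionLaw (F : fieldType) := FusionLaw {
  fl_set : set F ;
  fl_star : F -> F -> set F ;
  fl_set1 : fl_set 1 ;
  fl_starS : forall l m, fl_set l -> fl_set m -> fl_star l m `<=` fl_set
}.

(* A not necessarily associative or unital algebra is an lmodType A with a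
   bilinear product mul; A may have infinite dimension. *)
Section Algebra.
Context (F : fieldType) (A : lmodType F) (mul : {bilinear A -> A -> A}).

Definition eigenspace_of (a : A) (l : F) : set A :=
  [set u | mul a u = l *: u].

(* Sum of the eigenspaces for the eigenvalues in D. As eigenspaces for distinct
   eigenvalues are independent, it is automatically direct. *)
Definition eigensum (a : A) (D : set F) : set A :=
  [set u | exists (s : seq F) (v : F -> A),
     [/\ uniq s,
         forall l, l \in s -> D l /\ eigenspace_of a l (v l)
       & u = \sum_(l <- s) v l]].

Definition is_axis (L : fusionLaw F) (a : A) : Prop :=
  [/\ a != 0,
      mul a a = a,
      eigensum a (fl_set L) = setT
    & forall l m, fl_set L l -> fl_set L m ->
        forall u v, eigenspace_of a l u -> eigenspace_of a m v ->
        eigensum a (fl_star L l m) (mul u v)].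

Definition primitive (a : A) : Prop :=
  eigenspace_of a 1 = [set c *: a | c in [set: F]].

Definition is_subalgebra (B : set A) : Prop :=
  submod_closed (mem B) /\ (forall u v, B u -> B v -> B (mul u v)).

Definition generates (X : set A) : Prop := smallest is_subalgebra X = setT.

Definition primitive_axial_algebra (L : fusionLaw F) (X : set A) : Prop :=
  [/\ commutative mul,
      forall a, X a -> is_axis L a /\ primitive a
    & generates X].

Definition is_ideal (I : set A) : Prop :=
  submod_closed (mem I) /\
  (forall u v, I v -> I (mul u v) /\ I (mul v u)).

Definition largest_ideal_avoiding (X I : set A) : Prop :=
  [/\ is_ideal I,
      I `&` X = set0
    & forall K, is_ideal K -> K `&` X = set0 -> K `<=` I].

(* Definite description: the default value set0, which is not an ideal, is only
   taken when there is no largest ideal avoiding X. *)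
Definition axial_radical (X : set A) : set A :=
  xget set0 (largest_ideal_avoiding X).

Lemma axial_radicalE (X I : set A) :
  largest_ideal_avoiding X I -> axial_radical X = I.
Proof.
move=> XI; apply: xget_unique => // K [idK KX maxK].
by case: XI => idI IX maxI; apply/seteqP; split; [exact: maxI|exact: maxK].
Qed.

Definition maximal_ideal (M : set A) : Prop :=
  [/\ is_ideal M,
      M <> setT
    & forall K, is_ideal K -> M `<=` K -> K <> setT -> K = M].

(* The intersection over the empty family is setT. *)
Definition jacobson_radical : set A :=
  \bigcap_(M in [set M | maximal_ideal M]) M.

Definition frobenius_form (form : {biscalar A}) : Prop :=
  forall u v w, form (mul u v) w = form u (mul v w).

End Algebra.

Definition form_radical (F : fieldType) (A : lmodType F)
  (form : {biscalar A}) : set A :=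
  [set u | forall v, form u v = 0].

(* Main.v *)
(** The whole argument rests on one dichotomy: for an ideal [I], every axis [a]
    of [X] lies either in [I] or in the orthogonal ideal of [I].  Indeed [I]
    is stable under multiplication by [a], hence contains the eigencomponents of
    each of its elements; if [a] is not in [I], primitivity kills the
    1-component, and the other ones are orthogonal to [a].

    Consequently an ideal avoiding [X] is orthogonal to [X], hence to [A]; this
    gives [R(A) = A^perp].  An ideal containing both [I] and its orthogonal is
    the whole algebra; hence the orthogonal of the ideal generated by [a] is a
    maximal ideal, and it contains every ideal to which [a] does not belong.
    The maximal ideals are therefore exactly these orthogonals: they all contain
    [A^perp], and no axis of [X] belongs to all of them. *)
Require Import Defs.
From HB Require Import structures.
From mathcomp Require Import all_boot all_order all_algebra.
From mathcomp Require Import boolp classical_sets.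

Set Implicit Arguments.
Unset Strict Implicit.
Unset Printing Implicit Defensive.

Import GRing.Theory.
Local Open Scope classical_set_scope.
Local Open Scope ring_scope.

Section Submodules.
Context (F : fieldType) (A : lmodType F).
Implicit Types I : set A.

Lemma submod_closed_setP I :
  submod_closed (mem I) <->
  I 0 /\ forall (c : F) u v, I u -> I v -> I (c *: u + v).
Proof.
split=> [[I0 IL]|[I0 IL]]; split.
- by move: I0; rewrite inE.
- by move=> c u v Iu Iv; have := IL c u v; rewrite !inE; apply.
- by rewrite inE.
- by move=> c u v; rewrite !inE; apply: IL.
Qed.

Context {I} (smI : submod_closed (mem I)).

Lemma submod0 : I 0.
Proof. by case/submod_closed_setP: smI. Qed.

Lemma submodP (c : F) u v : I u -> I v -> I (c *: u + v).
Proof. by case/submod_closed_setP: smI => _; apply. Qed.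

Lemma submodZ (c : F) u : I u -> I (c *: u).
Proof. by move=> Iu; rewrite -[_ *: _]addr0; apply: submodP submod0. Qed.

Lemma submodD u v : I u -> I v -> I (u + v).
Proof. by move=> Iu Iv; rewrite -[u]scale1r; apply: submodP. Qed.

Lemma submodB u v : I u -> I v -> I (u - v).
Proof. by move=> Iu Iv; rewrite addrC -scaleN1r; apply: submodP. Qed.

Lemma submod_sum (T : eqType) (s : seq T) (v : T -> A) :
  (forall l, l \in s -> I (v l)) -> I (\sum_(l <- s) v l).
Proof.
by move=> sI; rewrite big_seq; apply: big_ind => //; [exact: submod0|exact: submodD].
Qed.

End Submodules.

Section Ideals.
Context (F : fieldType) (A : lmodType F) (mul : {bilinear A -> A -> A}).
Implicit Types (I K X : set A).

Lemma ideal_subalgebra I : is_ideal mul I -> is_subalgebra mul I.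
Proof. by case=> smI idI; split=> // u v _ Iv; case: (idI u v Iv). Qed.

(** An ideal is in particular a subalgebra. This is how properties pass from the axes to all of [A]:
    it suffices that the elements having the property form an ideal. *)
Lemma ideal_generators_eq_setT X I :
  generates mul X -> is_ideal mul I -> X `<=` I -> I = setT.
Proof.
move=> gX idI XI; apply/seteqP; split=> // u _.
have : smallest (is_subalgebra mul) X u by rewrite gX.
by apply; split=> //; apply: ideal_subalgebra.
Qed.

Lemma ideal_bigcap (T : Type) (P : set T) (G : T -> set A) :
  (forall i, P i -> is_ideal mul (G i)) -> is_ideal mul (\bigcap_(i in P) G i).
Proof.
move=> idG; split; [apply/submod_closed_setP; split|].
- by move=> i /idG [smG _]; apply: submod0 smG.
- move=> c u v Gu Gv i Pi; have [smG _] := idG i Pi.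
  by apply: (submodP smG); [exact: Gu|exact: Gv].
- move=> u v Gv; split=> i Pi; have [_ iG] := idG i Pi.
    by have [] := iG u v (Gv i Pi).
  by have [] := iG u v (Gv i Pi).
Qed.

Lemma ideal_smallest X : is_ideal mul (smallest (is_ideal mul) X).
Proof. by apply: ideal_bigcap => K []. Qed.

(* If u is the sum of the v l, then a u - l0 u has the components
   (l - l0) v l, so that the eigenvalue l0 can be removed. *)
Lemma ideal_eigencomponent I a (s : seq F) (v : F -> A) :
  is_ideal mul I -> uniq s ->
  (forall l, l \in s -> eigenspace_of mul a l (v l)) ->
  I (\sum_(l <- s) v l) -> forall l, l \in s -> I (v l).
Proof.
move=> [smI idI]; elim: s v => [//|l0 s IHs] v /= /andP[l0s us] eig Iu.
have Is l : l \in s -> I (v l).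
  move=> ls; have nz : l - l0 != 0.
    by rewrite subr_eq0; apply: contraNneq l0s => <-.
  rewrite -[v l]scale1r -(mulVf nz) -scalerA; apply: (submodZ smI).
  apply: (IHs (fun l => (l - l0) *: v l)) => // [k ks|].
    by rewrite /eigenspace_of /= linearZr /= eig ?inE ?ks ?orbT // !scalerA mulrC.
  have -> : \sum_(k <- s) (k - l0) *: v k =
      mul a (\sum_(k <- l0 :: s) v k) - l0 *: \sum_(k <- l0 :: s) v k.
    rewrite linear_sumr scaler_sumr -sumrB big_cons eig ?mem_head // subrr add0r.
    by apply: eq_big_seq => k ks; rewrite eig ?inE ?ks ?orbT // scalerBl.
  by apply: (submodB smI); [have [] := idI a _ Iu|apply: (submodZ smI)].
move=> l; rewrite inE => /predU1P[->|]; last exact: Is.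
(* The removed component is the total minus the others, which are now known to lie in [I]. *)
have -> : v l0 = \sum_(k <- l0 :: s) v k - \sum_(k <- s) v k.
  by rewrite big_cons addrK.
by apply: (submodB smI) => //; apply: (submod_sum smI).
Qed.

End Ideals.

Section FrobeniusForm.
Context (F : fieldType) (A : lmodType F) (mul : {bilinear A -> A -> A}).
Context (form : {biscalar A}).
Hypothesis frob : frobenius_form mul form.
Implicit Types (I K : set A).

Definition orthogonal_of (I : set A) : set A :=
  [set u | forall v, I v -> form u v = 0].

(** For [v] in [I], $(xu,v)=(x,uv)$ and [mul u v] is again in [I]; commutativity gives the other
    side. *)
Lemma ideal_orthogonal I :
  commutative mul -> is_ideal mul I -> is_ideal mul (orthogonal_of I).
Proof.
move=> mulC [smI idI]; split; [apply/submod_closed_setP; split|].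
- by move=> v _; rewrite linear0l.
- move=> c u w Iu Iw v Iv.
  by rewrite linearDl linearZl_LR /= Iu // Iw // mulr0 addr0.
- move=> u w; have H x : orthogonal_of I x -> orthogonal_of I (mul x u).
    by move=> Ix v Iv; rewrite frob Ix //; case: (idI u v Iv).
  by move=> Iw; split; last exact: H; rewrite mulC; apply: H.
Qed.

(** Idempotency gives $(a,u)=(aa,u)=(a,au)=l(a,u)$. *)
Lemma orthogonal_eigenspaces a (l : F) u :
  mul a a = a -> eigenspace_of mul a l u -> l != 1 -> form a u = 0.
Proof.
move=> aa au l1; have : form a u = l * form a u.
  by rewrite -{1}aa frob au linearZr_LR.
move/eqP; rewrite -subr_eq0 -{1}[form a u]mul1r -mulrBl mulf_eq0 subr_eq0.
by rewrite eq_sym (negPf l1) => /eqP.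
Qed.

Lemma axis_orthogonal (L : fusionLaw F) I a :
  is_axis mul L a -> primitive mul a -> is_ideal mul I -> ~ I a ->
  orthogonal_of I a.
Proof.
move=> [a0 aa sumT _] prim idI Ia u Iu.
have : eigensum mul a (fl_set L) u by rewrite sumT.
case=> s [v [us eig uE]]; rewrite uE in Iu *.
have {}eig l : l \in s -> eigenspace_of mul a l (v l) by move=> /eig[].
rewrite linear_sumr big_seq big1 // => l ls.
have [l1|] := eqVneq l 1; last exact: orthogonal_eigenspaces (eig _ ls).
have Ivl := ideal_eigencomponent idI us eig Iu ls.
have : eigenspace_of mul a 1 (v l) by rewrite -{1}l1; apply: eig.
(* The 1-component is [c *: a] and lies in [I], so a nonzero [c] would put [a] in [I]. *)
rewrite prim => -[c _ cE]; rewrite -cE; have [->|c0] := eqVneq c 0.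
  by rewrite scale0r linear0r.
case: Ia; rewrite -[a]scale1r -(mulVf c0) -scalerA cE.
by case: idI => smI _; apply: (submodZ smI).
Qed.

(* Products are symmetric against everything, and the generators, being
   idempotent, are products. *)
Lemma frobenius_form_sym (X : set A) :
  commutative mul -> generates mul X -> (forall a, X a -> mul a a = a) ->
  forall u v, form u v = form v u.
Proof.
move=> mulC gX idem u v.
pose B := [set u | forall v, form u v = form v u].
have Bmul x y : B (mul x y).
  (* $(xy,w)=(x,wy)=(xw,y)=(wx,y)=(w,xy)$. *)
  by move=> w; rewrite frob (mulC y w) -frob (mulC x w) frob.
suff -> : B u by [].
have -> : B = setT => //.
apply: (ideal_generators_eq_setT gX); last first.
  by move=> a /idem <-.
split; last by [].
apply/submod_closed_setP; split=> [w|c x y Bx By w].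
  by rewrite linear0l linear0r.
by rewrite linearDl linearDr linearZl_LR linearZr_LR /= Bx By.
Qed.

End FrobeniusForm.

Section PrimitiveAxialAlgebra.
Context (F : fieldType) (L : fusionLaw F) (A : lmodType F).
Context (mul : {bilinear A -> A -> A}) (X : set A) (form : {biscalar A}).
Hypothesis axial : primitive_axial_algebra mul L X.
Hypothesis frob : frobenius_form mul form.
Hypothesis form_neq0 : forall a, X a -> form a a != 0.
Implicit Types (I K M : set A).

Let mulC : commutative mul. Proof. by case: axial. Qed.
Let genX : generates mul X. Proof. by case: axial. Qed.
Let formC u v : form u v = form v u.
Proof.
apply: (frobenius_form_sym frob mulC genX) => a Xa.
by have [_ /(_ a Xa) [[]]] := axial.
Qed.

Let gen_ideal a := smallest (is_ideal mul) [set a].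

Lemma notin_ideal_orthogonal I a :
  is_ideal mul I -> X a -> ~ I a -> orthogonal_of form I a.
Proof.
move=> idI Xa; have [_ /(_ a Xa) [axa pra] _] := axial.
exact: (axis_orthogonal frob axa pra idI).
Qed.

Lemma form_radical_largest_ideal :
  largest_ideal_avoiding mul X (form_radical form).
Proof.
have perpT : form_radical form = orthogonal_of form setT.
  by apply/seteqP; split=> u Hu v *; apply: Hu.
split.
- rewrite perpT; apply: ideal_orthogonal => //; split=> //.
  by apply/submod_closed_setP.
- apply/seteqP; split=> // a [aR /form_neq0].
  by rewrite aR eqxx.
- move=> K idK KX u Ku v; rewrite formC.
  suff : orthogonal_of form K v by apply.
  have -> : orthogonal_of form K = setT => //.
  apply: (ideal_generators_eq_setT genX); first exact: ideal_orthogonal.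
  move=> a Xa; apply: notin_ideal_orthogonal => // Ka.
  by have : (K `&` X) a by []; rewrite KX.
Qed.

(** By the dichotomy, the orthogonal of [I] is an ideal containing [a], hence all of [gen_ideal a];
    symmetry of the form exchanges the two sides. *)
Lemma ideal_sub_orthogonal_gen I a :
  is_ideal mul I -> X a -> ~ I a -> I `<=` orthogonal_of form (gen_ideal a).
Proof.
move=> idI Xa Ia u Iu v; rewrite formC => av.
suff : orthogonal_of form I v by apply.
apply: av; split; first exact: ideal_orthogonal.
by move=> _ ->; apply: notin_ideal_orthogonal.
Qed.

(** As [a] lies in [gen_ideal a], membership would force $(a,a)=0$. *)
Lemma notin_orthogonal_gen a :
  X a -> ~ orthogonal_of form (gen_ideal a) a.
Proof.
move=> Xa /(_ a) aa0; have := form_neq0 Xa; rewrite aa0 ?eqxx //.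
by move=> I [_]; apply.
Qed.

Lemma maximal_ideal_orthogonal_gen a :
  X a -> maximal_ideal mul (orthogonal_of form (gen_ideal a)).
Proof.
move=> Xa; split.
- by apply: ideal_orthogonal => //; apply: ideal_smallest.
- by move=> NT; apply: (notin_orthogonal_gen Xa); rewrite NT.
- move=> K idK NK KT; apply/seteqP; split=> //.
  (* If [K] misses [a], it lies in the orthogonal. It remains to see that a [K] containing [a] is
     everything. *)
  apply: ideal_sub_orthogonal_gen => // Ka; apply: KT.
  apply: (ideal_generators_eq_setT genX) => // b Xb.
  (* Dichotomy for [gen_ideal a]: [b] is in its orthogonal or in the ideal itself, and [K] contains
     both. *)
  have [ab|ab] := pselect (gen_ideal a b); last first.
    apply: NK; apply: notin_ideal_orthogonal => //.
    exact: ideal_smallest.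
  by apply: ab; split=> // _ ->.
Qed.

(** A proper ideal misses some axis [a], so [M] lies in the orthogonal of [gen_ideal a], which is
    proper; maximality gives equality. *)
Lemma maximal_idealE M :
  maximal_ideal mul M ->
  exists2 a, X a & M = orthogonal_of form (gen_ideal a).
Proof.
move=> [idM MT maxM].
have [a Xa Ma] : exists2 a, X a & ~ M a.
  apply: contrapT => XM; apply: MT.
  apply: (ideal_generators_eq_setT genX) => // a Xa.
  by apply: contrapT => Ma; apply: XM; exists a.
exists a => //; have [idN NT _] := maximal_ideal_orthogonal_gen Xa.
by apply/esym/maxM => //; apply: ideal_sub_orthogonal_gen.
Qed.

Lemma jacobson_radicalE : jacobson_radical mul = form_radical form.
Proof.
apply/seteqP; split=> [|u Ru M /maximal_idealE[a _ ->] v _]; last exact: Ru.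
(* The intersection of the maximal ideals is an ideal avoiding [X], so it lies in the largest such
   ideal. *)
have [_ _] := form_radical_largest_ideal; apply.
  by apply: ideal_bigcap => M [].
apply/seteqP; split=> // a [Ja Xa].
exact: (notin_orthogonal_gen Xa) (Ja _ (maximal_ideal_orthogonal_gen Xa)).
Qed.

End PrimitiveAxialAlgebra.

Unset Implicit Arguments.
Set Strict Implicit.
Set Printing Implicit Defensive.

Theorem mainTheorem2 (F : fieldType) (L : fusionLaw F) (A : lmodType F)
    (mul : {bilinear A -> A -> A}) (X : set A) (form : {biscalar A}) :
  primitive_axial_algebra mul L X ->
  frobenius_form mul form ->
  (forall a, X a -> form a a != 0) ->
  axial_radical mul X = jacobson_radical mul /\
  jacobson_radical mul = form_radical form.
Proof.
move=> axial frob form_neq0.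
have JE := jacobson_radicalE axial frob form_neq0.
split=> //; rewrite JE.
exact/axial_radicalE/(form_radical_largest_ideal axial).
Qed.
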